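(* Let $\lambda\in\mathbb{R}$. For every integer $n\ge 0$ and every real $x$, \[ \int_{0}^{x}\mathrm{Bel}_{n,\lambda}(u)\,du= \frac{1}{n+1}\sum_{k=1}^{n+1}\binom{n+1}{k}\beta_{n+1-k,\lambda}\,\mathrm{Bel}_{k,\lambda}(x). \]
   Context: For $\lambda\in\mathbb{R}$, $(x)_{0,\lambda}=1$ and $(x)_{n,\lambda}=x(x-\lambda)\cdots(x-(n-1)\lambda)$ for $n\ge1$. The degenerate exponential is $e_\lambda(t)=\sum_{k\ge0}(1)_{k,\lambda}t^k/k!$ (equal to $(1+\lambda t)^{1/\lambda}$ for $\lambda\ne0$, $e^t$ for $\lambda=0$). The degenerate Bell polynomials are defined by $e^{x(e_{\lambda}(t)-1)}=\sum_{n=0}^{\infty}\mathrm{Bel}_{n,\lambda}(x)\frac{t^{n}}{n!}$. Carlitz's degenerate Bernoulli numbers $\beta_{n,\lambda}$ are defined by $\frac{t}{e_{\lambda}(t)-1}=\sum_{n=0}^{\infty}\beta_{n,\lambda}\frac{t^{n}}{n!}$. *)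

(* Defs.v *)
From Stdlib Require Import Reals Factorial.
From Coquelicot Require Import Coquelicot.
Open Scope R_scope.

Fixpoint dfall (lam x : R) (n : nat) : R :=
  match n with
  | O => 1
  | S m => dfall lam x m * (x - INR m * lam)
  end.

(* For lam <> 0 the series converges on |t| < 1/|lam|; only its values for t
   near 0 are used below. *)
Definition dexp (lam t : R) : R :=
  PSeries (fun k => dfall lam 1 k / INR (fact k)) t.

(* f(t) = sum_n a_n t^n / n! for all t <> 0 in some neighbourhood of 0.  The
   neighbourhood is punctured so that t / (dexp lam t - 1), whose singularity
   at t = 0 is removable, is not evaluated at 0 (where Rocq's total division
   gives 0).  A power series being continuous at 0, this determines every
   a_n, including a_0. *)
Definition is_egf (a : nat -> R) (f : R -> R) : Prop :=
  locally' 0 (fun t => is_pseries (fun n => a n / INR (fact n)) t (f t)).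

Definition is_degenerate_bell (lam : R) (Bel : nat -> R -> R) : Prop :=
  forall x : R,
    is_egf (fun n => Bel n x) (fun t => exp (x * (dexp lam t - 1))).

Definition is_degenerate_bernoulli (lam : R) (beta : nat -> R) : Prop :=
  is_egf beta (fun t => t / (dexp lam t - 1)).

(* Main.v *)
Require Import Defs.
From Stdlib Require Import Arith Reals Lra Lia.
From Coquelicot Require Import Coquelicot.
Open Scope R_scope.

(* Write B_n = Bel_n / n! and q(t) = (e_lam(t) - 1) / t = sum_k q_k t^k.
   Differentiating the generating function in t gives a recursion for the B_n
   in which B_{n+1}(x) has a factor x; hence B_{n+1}(0) = 0 and
   B_{n+1}'(0) = q_n.  The addition formula
   B_n(x + h) = sum_k B_k(x) B_{n-k}(h) carries the derivative from 0 to x: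
   B_{n+1}'(x) = sum_{k <= n} B_k(x) q_{n-k}.  The Bernoulli generating function
   is 1/q, so convolving this with beta_k / k! returns B_n(x): the right-hand
   side, which vanishes at x = 0, is a primitive of Bel_n. *)

(** * Power series representing a function near 0 *)

(* Unlike [is_egf], the neighbourhood is not punctured. *)
Definition ps_rep (a : nat -> R) (f : R -> R) : Prop :=
  Rbar_lt 0 (CV_radius a) /\ locally 0 (fun t => PSeries a t = f t).

(** Beyond the radius of convergence the terms do not tend to 0, so convergence at [t] forces the
    radius to be at least |t|. *)
Lemma CV_radius_pos (a : nat -> R) (t : R) :
  t <> 0 -> ex_pseries a t -> Rbar_lt 0 (CV_radius a).
Proof.
  intros ht hex.
  apply Rbar_lt_le_trans with (Rabs t).
  - now apply Rabs_pos_lt.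
  - apply Rbar_not_lt_le; intros hlt.
    apply (CV_disk_outside _ _ hlt).
    apply ex_series_lim_0.
    apply ex_pseries_R; exact hex.
Qed.

Lemma locally_lt_CV_radius (a : nat -> R) :
  Rbar_lt 0 (CV_radius a) ->
  locally 0 (fun t => Rbar_lt (Rabs t) (CV_radius a)).
Proof.
  intros ha.
  assert (hr : exists r : posreal, Rbar_le r (CV_radius a)).
  { destruct (CV_radius a) as [r | |]; simpl in ha.
    - exists (mkposreal r ha); simpl; lra.
    - exists (mkposreal 1 Rlt_0_1); exact I.
    - contradiction. }
  destruct hr as [r hr].
  exists r; intros t ht.
  apply Rbar_lt_le_trans with r; [| exact hr].
  change (Rabs (t - 0) < r) in ht.
  now rewrite Rminus_0_r in ht.
Qed.

Lemma locally_0_nonzero (P : R -> Prop) :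
  locally 0 P -> exists t, t <> 0 /\ P t.
Proof.
  intros [r hr].
  exists (r / 2).
  assert (h := cond_pos r).
  split; [lra |].
  apply hr.
  change (Rabs (r / 2 - 0) < r).
  rewrite Rabs_pos_eq; lra.
Qed.

Lemma ps_rep_value_0 (a : nat -> R) (f : R -> R) : ps_rep a f -> a O = f 0.
Proof.
  intros [_ h].
  rewrite <- (PSeries_0 a).
  exact (locally_singleton _ _ h).
Qed.

Lemma ps_rep_unique (a b : nat -> R) (f : R -> R) (n : nat) :
  ps_rep a f -> ps_rep b f -> a n = b n.
Proof.
  intros [ha haf] [hb hbf].
  apply PSeries_ext_recip; try assumption.
  generalize (filter_and _ _ haf hbf).
  apply filter_imp; intros t [-> ->]; reflexivity.
Qed.

Lemma ps_rep_ext (a : nat -> R) (f g : R -> R) :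
  locally 0 (fun t => f t = g t) -> ps_rep a f -> ps_rep a g.
Proof.
  intros hfg [ha haf].
  split; [exact ha |].
  generalize (filter_and _ _ hfg haf).
  apply filter_imp; intros t [<- ->]; reflexivity.
Qed.

Lemma ps_rep_PSeries (a : nat -> R) :
  Rbar_lt 0 (CV_radius a) -> ps_rep a (PSeries a).
Proof.
  intros ha; split; [exact ha |].
  apply filter_forall; reflexivity.
Qed.

Lemma ps_rep_mult (a b : nat -> R) (f g : R -> R) :
  ps_rep a f -> ps_rep b g -> ps_rep (PS_mult a b) (fun t => f t * g t).
Proof.
  intros [ha haf] [hb hbg].
  assert (hr := filter_and _ _ (locally_lt_CV_radius a ha)
                  (locally_lt_CV_radius b hb)).
  split.
  - destruct (locally_0_nonzero _ hr) as [t [ht [hta htb]]].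
    apply (CV_radius_pos _ t ht).
    now apply ex_pseries_mult.
  - generalize (filter_and _ _ hr (filter_and _ _ haf hbg)).
    apply filter_imp; intros t [[hta htb] [<- <-]].
    now apply PSeries_mult.
Qed.

Lemma ps_rep_scal (c : R) (a : nat -> R) (f : R -> R) :
  ps_rep a f -> ps_rep (PS_scal c a) (fun t => c * f t).
Proof.
  intros [ha haf]; split.
  - destruct (locally_0_nonzero _ (locally_lt_CV_radius a ha)) as [t [ht hta]].
    apply (CV_radius_pos _ t ht).
    apply ex_pseries_scal; [apply Rmult_comm |].
    now apply CV_radius_inside.
  - revert haf; apply filter_imp; intros t <-.
    apply PSeries_scal.
Qed.

Lemma ps_rep_derive (a : nat -> R) (f f' : R -> R) :
  ps_rep a f -> locally 0 (fun t => is_derive f t (f' t)) ->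
  ps_rep (PS_derive a) f'.
Proof.
  intros [ha haf] hf.
  split; [now rewrite CV_radius_derive |].
  (* Differentiating at [t] needs the equality on a neighbourhood of [t], not only at [t]. *)
  generalize (filter_and _ _ (locally_locally _ _ haf)
                (filter_and _ _ (locally_lt_CV_radius a ha) hf)).
  apply filter_imp; intros t [heq [hta ht]].
  rewrite <- (Derive_PSeries _ _ hta), (Derive_ext_loc _ _ _ heq).
  now apply is_derive_unique.
Qed.

(** Fills in the puncture: [g] is the continuous extension of [f]. The series and [g] are both
    continuous at 0 and agree off 0, so their values at 0 are the same limit. *)
Lemma ps_rep_egf (a : nat -> R) (f g : R -> R) :
  is_egf a f -> continuous g 0 -> locally' 0 (fun t => f t = g t) ->
  ps_rep (fun n => a n / INR (fact n)) g.
Proof.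
  intros haf hg hfg.
  set (a' := fun n => a n / INR (fact n)).
  assert (hps : locally' 0 (fun t => is_pseries a' t (g t))).
  { generalize (filter_and _ _ haf hfg).
    apply filter_imp; intros t [h <-]; exact h. }
  assert (ha : Rbar_lt 0 (CV_radius a')).
  { destruct (locally_0_nonzero _ hps) as [t [ht h]].
    apply (CV_radius_pos _ t ht).
    exists (g t); now apply h. }
  split; [exact ha |].
  assert (h0 : PSeries a' 0 = g 0).
  { assert (hl : forall u : R -> R, continuous u 0 -> is_lim u 0 (u 0)).
    { intros u hu.
      apply is_lim_continuity; now apply continuity_pt_filterlim. }
    apply Rbar_finite_eq.
    rewrite <- (is_lim_unique _ _ _ (hl g hg)).
    symmetry; apply is_lim_unique.
    apply (is_lim_ext_loc (PSeries a')).
    - revert hps; apply filter_imp; intros t ht.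
      now apply is_pseries_unique.
    - apply is_lim_continuity, PSeries_continuity.
      now rewrite Rabs_R0. }
  revert hps; unfold locally', within; apply filter_imp; intros t ht.
  destruct (Req_dec t 0) as [-> | hn]; [exact h0 |].
  apply is_pseries_unique; now apply ht.
Qed.

Lemma is_derive_sum_f_R0 (g : nat -> R -> R) (l : nat -> R) (x : R) (n : nat) :
  (forall k, (k <= n)%nat -> is_derive (g k) x (l k)) ->
  is_derive (fun y => sum_f_R0 (fun k => g k y) n) x (sum_f_R0 l n).
Proof.
  induction n as [| n IH]; intros h; simpl.
  - apply (is_derive_ext (g O)); [reflexivity |].
    now apply h.
  - apply (is_derive_plus (fun y => sum_f_R0 (fun k => g k y) n) (g (S n))).
    + apply IH; intros k hk; apply h; lia.
    + now apply h.
Qed.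

(** * The degenerate exponential and the Bernoulli generating function *)

Definition dexp_coef (lam : R) (k : nat) : R := dfall lam 1 k / INR (fact k).

Lemma dexp_coef_0 (lam : R) : dexp_coef lam 0 = 1.
Proof. unfold dexp_coef; simpl; field. Qed.

Lemma dexp_coef_1 (lam : R) : dexp_coef lam 1 = 1.
Proof. unfold dexp_coef; simpl; field. Qed.

Lemma dexp_coef_S (lam : R) (k : nat) :
  dexp_coef lam (S k) = dexp_coef lam k * ((1 - INR k * lam) / INR (S k)).
Proof.
  unfold dexp_coef; cbn [dfall].
  rewrite fact_simpl, mult_INR.
  field; split; [now apply not_0_INR | apply INR_fact_neq_0].
Qed.

(** Consecutive coefficients have ratio (1 - k lam) / (k + 1), of absolute value at most 1 +
    |lam|. *)
Lemma dexp_coef_bound (lam : R) (k : nat) :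
  Rabs (dexp_coef lam k) <= (1 + Rabs lam) ^ k.
Proof.
  induction k as [| k IH].
  - rewrite dexp_coef_0, Rabs_R1; simpl; lra.
  - rewrite dexp_coef_S, Rabs_mult, <- tech_pow_Rmult, Rmult_comm.
    apply Rmult_le_compat; try apply Rabs_pos; [| exact IH].
    assert (hk := pos_INR k).
    assert (hl := Rabs_pos lam).
    rewrite S_INR.
    rewrite Rabs_div by lra.
    rewrite (Rabs_pos_eq (INR k + 1)) by lra.
    apply Rle_div_l; [lra |].
    unfold Rminus.
    eapply Rle_trans; [apply Rabs_triang |].
    rewrite Rabs_Ropp, Rabs_mult, Rabs_R1, (Rabs_pos_eq (INR k)) by lra.
    nra.
Qed.

Lemma CV_radius_dexp (lam : R) : Rbar_lt 0 (CV_radius (dexp_coef lam)).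
Proof.
  assert (hl := Rabs_pos lam).
  (* Chosen so that (1 + |lam|) r = 1/2: at [r] the series is dominated by a geometric one. *)
  set (r := / (2 * (1 + Rabs lam))).
  assert (hr : 0 < r) by (apply Rinv_0_lt_compat; lra).
  apply (CV_radius_pos _ r); [lra |].
  apply ex_pseries_R, ex_series_Rabs.
  apply (@ex_series_le _ R_CompleteNormedModule _ (fun k => (/ 2) ^ k)).
  - intros k.
    change (Rabs (Rabs (dexp_coef lam k * r ^ k)) <= (/ 2) ^ k).
    rewrite Rabs_Rabsolu, Rabs_mult, (Rabs_pos_eq (r ^ k))
      by (apply pow_le; lra).
    replace (/ 2) with ((1 + Rabs lam) * r) by (unfold r; field; lra).
    rewrite Rpow_mult_distr.
    apply Rmult_le_compat_r; [apply pow_le; lra | apply dexp_coef_bound].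
  - apply ex_series_geom; rewrite Rabs_pos_eq; lra.
Qed.

Lemma continuous_PSeries_0 (a : nat -> R) :
  Rbar_lt 0 (CV_radius a) -> continuous (PSeries a) 0.
Proof.
  intros ha.
  apply continuity_pt_filterlim, PSeries_continuity.
  now rewrite Rabs_R0.
Qed.

(* The coefficients of [(dexp lam t - 1) / t], singularity removed. *)
Definition dexp_quot (lam : R) (k : nat) : R := dexp_coef lam (S k).

Lemma CV_radius_dexp_quot (lam : R) : Rbar_lt 0 (CV_radius (dexp_quot lam)).
Proof.
  destruct (locally_0_nonzero _ (locally_lt_CV_radius _ (CV_radius_dexp lam)))
    as [t [ht hta]].
  apply (CV_radius_pos _ t ht).
  apply (ex_pseries_decr_1 (dexp_coef lam) t).
  (* At a nonzero [t] the shifted series is the original one, less its constant term, divided by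
     [t]. *)
  - right; exists (/ t); now apply Rinv_l.
  - now apply CV_radius_inside.
Qed.

Lemma dexp_sub_1 (lam : R) :
  locally 0 (fun t => dexp lam t - 1 = t * PSeries (dexp_quot lam) t).
Proof.
  generalize (locally_lt_CV_radius _ (CV_radius_dexp lam)).
  apply filter_imp; intros t ht.
  change (dexp lam t) with (PSeries (dexp_coef lam) t).
  rewrite PSeries_decr_1 by now apply CV_radius_inside.
  rewrite dexp_coef_0.
  change (PSeries (PS_decr_1 (dexp_coef lam)) t)
    with (PSeries (dexp_quot lam) t).
  ring.
Qed.

Lemma dexp_quot_nonzero (lam : R) :
  locally 0 (fun t => PSeries (dexp_quot lam) t <> 0).
Proof.
  apply (continuous_PSeries_0 _ (CV_radius_dexp_quot lam) (fun y => y <> 0)).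
  apply open_neq.
  rewrite PSeries_0; unfold dexp_quot; rewrite dexp_coef_1; lra.
Qed.

(** Off 0 the factor t cancels in t / (t q(t)), and 1/q is continuous at 0 because q(0) = 1. *)
Lemma bernoulli_rep (lam : R) (beta : nat -> R) :
  is_degenerate_bernoulli lam beta ->
  ps_rep (fun n => beta n / INR (fact n)) (fun t => / PSeries (dexp_quot lam) t).
Proof.
  intros h.
  apply (ps_rep_egf _ _ _ h).
  - apply continuous_Rinv_comp.
    + apply continuous_PSeries_0, CV_radius_dexp_quot.
    + exact (locally_singleton _ _ (dexp_quot_nonzero lam)).
  - generalize (filter_and _ _ (dexp_sub_1 lam) (dexp_quot_nonzero lam)).
    unfold locally', within; apply filter_imp; intros t [-> hq] ht.
    field; split; [exact hq | exact ht].
Qed.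

(** * The Bell generating function: recursion and addition formula *)

Definition bell_gf (lam x t : R) : R := exp (x * (dexp lam t - 1)).

Lemma bell_gf_0 (lam x : R) : bell_gf lam x 0 = 1.
Proof.
  unfold bell_gf.
  change (dexp lam 0) with (PSeries (dexp_coef lam) 0).
  rewrite PSeries_0, dexp_coef_0, Rminus_diag, Rmult_0_r.
  apply exp_0.
Qed.

Lemma is_derive_bell_gf (lam x : R) :
  locally 0 (fun t => is_derive (bell_gf lam x) t
    (x * (PSeries (PS_derive (dexp_coef lam)) t * bell_gf lam x t))).
Proof.
  generalize (locally_lt_CV_radius _ (CV_radius_dexp lam)).
  apply filter_imp; intros t ht.
  assert (hd : is_derive (dexp lam) t (PSeries (PS_derive (dexp_coef lam)) t))
    by exact (is_derive_PSeries (dexp_coef lam) t ht).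
  unfold bell_gf.
  auto_derive.
  - eexists; exact hd.
  - change (Derive (fun s => dexp lam s) t) with (Derive (dexp lam) t).
    rewrite (is_derive_unique _ _ _ hd); unfold Rminus; ring.
Qed.

Section Bell.

Variables (lam : R) (Bel : nat -> R -> R).
Hypothesis hBel : is_degenerate_bell lam Bel.

Let B (x : R) (n : nat) : R := Bel n x / INR (fact n).

Lemma bell_rep (x : R) : ps_rep (B x) (bell_gf lam x).
Proof.
  apply (ps_rep_egf _ _ _ (hBel x)).
  - apply (ex_derive_continuous (bell_gf lam x)).
    eexists.
    exact (locally_singleton _ _ (is_derive_bell_gf lam x)).
  - apply filter_forall; reflexivity.
Qed.

Lemma bell_0 (x : R) : B x 0 = 1.
Proof.
  rewrite (ps_rep_value_0 _ _ (bell_rep x)); apply bell_gf_0.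
Qed.

(** Compares the coefficients of t^n in G' = x e_lam' G, where G is the generating function; the
    coefficient of t^k in e_lam' is (k + 1) q_k. *)
Lemma bell_S (x : R) (n : nat) :
  B x (S n) =
  x * (/ INR (S n) *
       sum_f_R0 (fun k => INR (S k) * dexp_quot lam k * B x (n - k)) n).
Proof.
  assert (h : PS_derive (B x) n =
              PS_scal x (PS_mult (PS_derive (dexp_coef lam)) (B x)) n).
  { apply ps_rep_unique with
      (fun t => x * (PSeries (PS_derive (dexp_coef lam)) t * bell_gf lam x t)).
    - apply (ps_rep_derive _ _ _ (bell_rep x)), is_derive_bell_gf.
    - apply ps_rep_scal, ps_rep_mult; [| apply bell_rep].
      apply ps_rep_PSeries; rewrite CV_radius_derive; apply CV_radius_dexp. }
  change (INR (S n) * B x (S n) = x *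
    sum_f_R0 (fun k => INR (S k) * dexp_quot lam k * B x (n - k)) n) in h.
  assert (hn : INR (S n) <> 0) by now apply not_0_INR.
  apply Rmult_eq_reg_l with (INR (S n)); [| exact hn].
  rewrite h; field; exact hn.
Qed.

Lemma bell_S_at_0 (n : nat) : B 0 (S n) = 0.
Proof. rewrite bell_S; ring. Qed.

Lemma bell_add (x h : R) (n : nat) :
  B (x + h) n = PS_mult (B x) (B h) n.
Proof.
  apply ps_rep_unique with (bell_gf lam (x + h)); [apply bell_rep |].
  apply (ps_rep_ext _ (fun t => bell_gf lam x t * bell_gf lam h t)).
  - apply filter_forall; intros t.
    unfold bell_gf; rewrite <- exp_plus; f_equal; ring.
  - apply ps_rep_mult; apply bell_rep.
Qed.

(** * Derivatives of the Bell polynomials in x *)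

Let D (n : nat) : R := PS_incr_1 (dexp_quot lam) n.

(** [D] lists the coefficients of e_lam(t) - 1, the x-derivative of the generating function at x =
    0. The recursion reads B_{n+1}(y) = y g(y); strong induction makes g differentiable at 0, and
    the product rule there leaves g(0). *)
Lemma is_derive_bell_at_0 (n : nat) : is_derive (fun y => B y n) 0 (D n).
Proof.
  induction n as [n IH] using lt_wf_ind.
  destruct n as [| n].
  - apply (is_derive_ext (fun _ => 1)); [intros y; now rewrite bell_0 |].
    apply is_derive_const.
  - set (g := fun y => / INR (S n) *
      sum_f_R0 (fun k => INR (S k) * dexp_quot lam k * B y (n - k)) n).
    apply (is_derive_ext (fun y => y * g y)).
    { intros y; symmetry; apply bell_S. }
    assert (hg : is_derive g 0 (/ INR (S n) *
      sum_f_R0 (fun k => INR (S k) * dexp_quot lam k * D (n - k)) n)).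
    { apply is_derive_scal.
      apply (is_derive_sum_f_R0
               (fun k y => INR (S k) * dexp_quot lam k * B y (n - k))).
      intros k hk; apply is_derive_scal, IH; lia. }
    (* Since B_j(0) = 0 for j > 0, only the term k = n survives. *)
    assert (hg0 : g 0 = D (S n)).
    { assert (hn : INR (S n) <> 0) by now apply not_0_INR.
      unfold g.
      assert (hs : forall m, (forall j, (j < m)%nat ->
                 INR (S j) * dexp_quot lam j * B 0 (m - j) = 0) ->
               sum_f_R0 (fun k => INR (S k) * dexp_quot lam k * B 0 (m - k)) m
               = INR (S m) * dexp_quot lam m * B 0 (m - m)).
      { intros [| m] hm; [reflexivity |].
        rewrite tech5, (sum_eq _ (fun _ => 0)).
        - rewrite sum_cte; ring.
        - intros j hj; apply hm; lia. }
      rewrite hs.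
      - rewrite Nat.sub_diag, bell_0.
        change (D (S n)) with (dexp_quot lam n).
        field; exact hn.
      - intros j hj; replace (n - j)%nat with (S (n - S j)) by lia.
        rewrite bell_S_at_0; ring. }
    rewrite <- hg0.
    auto_derive.
    + eexists; exact hg.
    + ring.
Qed.

(** With y = x + (y - x), the addition formula leaves y only in factors B_j(y - x), which are
    differentiated at argument 0. *)
Lemma is_derive_bell (n : nat) (x : R) :
  is_derive (fun y => B y n) x (PS_mult (B x) D n).
Proof.
  apply (is_derive_ext (fun y => PS_mult (B x) (B (y - x)) n)).
  { intros y; rewrite <- bell_add; f_equal; ring. }
  apply (is_derive_sum_f_R0 (fun k y => B x k * B (y - x) (n - k))).
  intros k _.
  apply is_derive_scal.
  (* The 1 is the derivative of y - x, as the chain rule expects it. *)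
  replace (D (n - k)) with (scal 1 (D (n - k))) by apply Rmult_1_l.
  apply (is_derive_comp (fun z => B z (n - k)) (fun y => y - x)).
  - rewrite Rminus_diag; apply is_derive_bell_at_0.
  - auto_derive; [exact I | ring].
Qed.

Lemma is_derive_bell_S (n : nat) (x : R) :
  is_derive (fun y => B y (S n)) x (PS_mult (B x) (dexp_quot lam) n).
Proof.
  replace (PS_mult (B x) (dexp_quot lam) n) with (PS_mult (B x) D (S n)).
  - apply is_derive_bell.
  - unfold PS_mult.
    (* The last term, k = n + 1, carries [D 0], which is 0; in the others D_{n+1-k} = q_{n-k}. *)
    rewrite tech5, Nat.sub_diag.
    change (D 0) with 0.
    rewrite Rmult_0_r, Rplus_0_r.
    apply sum_eq; intros k hk.
    now replace (S n - k)%nat with (S (n - k)) by lia.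
Qed.

Lemma continuous_bell (n : nat) (x : R) : continuous (Bel n) x.
Proof.
  apply (continuous_ext (fun y => INR (fact n) * B y n)).
  - intros y.
    change (INR (fact n) * (Bel n y / INR (fact n)) = Bel n y).
    field; apply INR_fact_neq_0.
  - apply (ex_derive_continuous (fun y => INR (fact n) * B y n)); eexists.
    apply is_derive_scal, is_derive_bell.
Qed.

(** * Inversion by the Bernoulli numbers and integration *)

Variable beta : nat -> R.
Hypothesis hbeta : is_degenerate_bernoulli lam beta.

Let b (n : nat) : R := beta n / INR (fact n).

(** Coefficients of G q (1/q) = G, valid near 0, where q does not vanish. *)
Lemma bell_mult_bernoulli (x : R) (n : nat) :
  PS_mult (PS_mult (B x) (dexp_quot lam)) b n = B x n.
Proof.
  apply ps_rep_unique with (bell_gf lam x); [| apply bell_rep].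
  apply (ps_rep_ext _ (fun t => bell_gf lam x t * PSeries (dexp_quot lam) t
                                * / PSeries (dexp_quot lam) t)).
  - generalize (dexp_quot_nonzero lam); apply filter_imp; intros t ht.
    now field.
  - apply ps_rep_mult; [apply ps_rep_mult |].
    + apply bell_rep.
    + apply ps_rep_PSeries, CV_radius_dexp_quot.
    + now apply bernoulli_rep.
Qed.

(** The right-hand side of the theorem with its index shifted to start at 0 and the binomials
    absorbed into [b] and [B], so that its derivative is a Cauchy product. *)
Definition bell_primitive (n : nat) (x : R) : R :=
  INR (fact n) * sum_f_R0 (fun k => b (n - k) * B x (S k)) n.

Lemma is_derive_bell_primitive (n : nat) (x : R) :
  is_derive (bell_primitive n) x (Bel n x).
Proof.
  replace (Bel n x) with
    (INR (fact n) * sum_f_R0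
       (fun k => b (n - k) * PS_mult (B x) (dexp_quot lam) k) n).
  - apply is_derive_scal.
    apply (is_derive_sum_f_R0 (fun k y => b (n - k) * B y (S k))).
    intros k _; apply is_derive_scal, is_derive_bell_S.
  - rewrite (sum_eq _ (fun k => PS_mult (B x) (dexp_quot lam) k * b (n - k)))
      by (intros; ring).
    change (INR (fact n) * PS_mult (PS_mult (B x) (dexp_quot lam)) b n
            = Bel n x).
    rewrite bell_mult_bernoulli; unfold B; field; apply INR_fact_neq_0.
Qed.

Lemma bell_primitive_at_0 (n : nat) : bell_primitive n 0 = 0.
Proof.
  unfold bell_primitive.
  rewrite (sum_eq _ (fun _ => 0)).
  - rewrite sum_cte; ring.
  - intros k _; rewrite bell_S_at_0; ring.
Qed.

Lemma bell_primitive_eq (n : nat) (x : R) :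
  bell_primitive n x =
  / INR (n + 1) *
  sum_n_m (fun k => Binomial.C (n + 1) k * beta (n + 1 - k)%nat * Bel k x)
    1 (n + 1).
Proof.
  rewrite Nat.add_1_r, <- sum_n_m_S.
  change (bell_primitive n x = / INR (S n) * sum_n (fun k =>
    Binomial.C (S n) (S k) * beta (S n - S k)%nat * Bel (S k) x) n).
  rewrite sum_n_Reals, scal_sum.
  unfold bell_primitive; rewrite scal_sum.
  (* Termwise, C(n+1, k+1) / (n+1) = n! / ((k+1)! (n-k)!). *)
  apply sum_eq; intros k hk.
  unfold Binomial.C, B, b.
  rewrite (fact_simpl n), mult_INR.
  cbn [Nat.sub].
  field; repeat split; try apply INR_fact_neq_0; now apply not_0_INR.
Qed.

(** Fundamental theorem of calculus, with a primitive that vanishes at 0. *)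
Lemma is_RInt_bell (n : nat) (x : R) :
  is_RInt (Bel n) 0 x (bell_primitive n x).
Proof.
  replace (bell_primitive n x)
    with (minus (bell_primitive n x) (bell_primitive n 0)).
  - apply (is_RInt_derive (bell_primitive n)); intros y _.
    + apply is_derive_bell_primitive.
    + apply continuous_bell.
  - rewrite bell_primitive_at_0; apply Rminus_0_r.
Qed.

End Bell.

Theorem theorem9 (lam : R) (Bel : nat -> R -> R) (beta : nat -> R)
    (hBel : is_degenerate_bell lam Bel)
    (hbeta : is_degenerate_bernoulli lam beta)
    (n : nat) (x : R) :
  is_RInt (Bel n) 0 x
    (/ INR (n + 1) *
     sum_n_m (fun k => Binomial.C (n + 1) k * beta (n + 1 - k)%nat * Bel k x)
       1 (n + 1)).
Proof.
  rewrite <- bell_primitive_eq.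
  now apply (is_RInt_bell lam).
Qed.
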